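(* Every subdirectly irreducible medial quandle with more than two elements is either latin or quasi-reductive.
   Context: A quandle is an algebra $(Q,\ast,\backslash)$ with two binary operations such that for all $x,y,z\in Q$: $x\ast x=x$; $x\ast(y\ast z)=(x\ast y)\ast(x\ast z)$; $x\backslash(x\ast y)=y=x\ast(x\backslash y)$. It is medial if for all $x,y,u,v$: $(x\ast y)\ast(u\ast v)=(x\ast u)\ast(y\ast v)$, $(x\backslash y)\backslash(u\backslash v)=(x\backslash u)\backslash(y\backslash v)$ and $(x\backslash y)\ast(u\backslash v)=(x\ast u)\backslash(y\ast v)$. Let $L_a\colon x\mapsto a\ast x$ and $R_a\colon x\mapsto x\ast a$. A quandle is latin if every $R_a$ is a bijection. The orbits of $Q$ are the orbits of the permutation group generated by all $L_a$, $a\in Q$. A quandle $Q$ is quasi-reductive if there exist two different elements $a,b\in Q$ lying in the same orbit such that $L_a=L_b$. An algebra is subdirectly irreducible if the intersection of all its non-trivial congruences (congruences different from equality) is non-trivial. *)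

(* Defs.v *)
From mathcomp Require Import all_boot.

Set Implicit Arguments.
Unset Strict Implicit.
Unset Printing Implicit Defensive.

Declare Scope quandle_scope.
Delimit Scope quandle_scope with quandle.

Record quandle := Quandle {
  quandle_sort :> Type;
  qop : quandle_sort -> quandle_sort -> quandle_sort;
  qldiv : quandle_sort -> quandle_sort -> quandle_sort;
  qop_idem : forall x, qop x x = x;
  qop_distr : forall x y z, qop x (qop y z) = qop (qop x y) (qop x z);
  qop_ldivK : forall x y, qldiv x (qop x y) = y;
  qldiv_opK : forall x y, qop x (qldiv x y) = y
}.

Notation "x * y" := (qop x y) : quandle_scope.
Notation "x \ y" := (qldiv x y) (at level 40, left associativity) : quandle_scope.

Local Open Scope quandle_scope.

Definition medial (Q : quandle) : Prop :=
  [/\ forall x y u v : Q, (x * y) * (u * v) = (x * u) * (y * v),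
      forall x y u v : Q, (x \ y) \ (u \ v) = (x \ u) \ (y \ v)
    & forall x y u v : Q, (x \ y) * (u \ v) = (x * u) \ (y * v)].

Definition ltrans (Q : quandle) (a : Q) : Q -> Q := fun x => a * x.
Definition rtrans (Q : quandle) (a : Q) : Q -> Q := fun x => x * a.

Definition latin (Q : quandle) : Prop := forall a : Q, bijective (rtrans a).

(* The permutation group generated by the left translations, as a set of maps. *)
Inductive left_mul_group (Q : quandle) : (Q -> Q) -> Prop :=
| lmg_gen (a : Q) : left_mul_group (ltrans a)
| lmg_id : left_mul_group id
| lmg_comp (f g : Q -> Q) :
    left_mul_group f -> left_mul_group g -> left_mul_group (f \o g)
| lmg_inv (f g : Q -> Q) :
    left_mul_group f -> cancel f g -> cancel g f -> left_mul_group g.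

Definition same_orbit (Q : quandle) (x y : Q) : Prop :=
  exists2 f : Q -> Q, left_mul_group f & f x = y.

Definition quasi_reductive (Q : quandle) : Prop :=
  exists a b : Q, [/\ a <> b, same_orbit a b & ltrans a =1 ltrans b].

Record congruence (Q : quandle) (r : Q -> Q -> Prop) : Prop := Congruence {
  congr_refl : forall x, r x x;
  congr_sym : forall x y, r x y -> r y x;
  congr_trans : forall x y z, r x y -> r y z -> r x z;
  congr_op : forall x x' y y', r x x' -> r y y' -> r (x * y) (x' * y');
  congr_ldiv : forall x x' y y', r x x' -> r y y' -> r (x \ y) (x' \ y')
}.

Definition nontrivial_rel (T : Type) (r : T -> T -> Prop) : Prop :=
  exists x y : T, r x y /\ x <> y.

(* Without non-trivial congruences (at most one element) the intersection is
   the full relation, so such a quandle is not subdirectly irreducible. *)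
Definition monolith (Q : quandle) (x y : Q) : Prop :=
  forall r : Q -> Q -> Prop, congruence r -> nontrivial_rel r -> r x y.

Definition subdirectly_irreducible (Q : quandle) : Prop :=
  nontrivial_rel (@monolith Q).

Definition more_than_two (T : Type) : Prop :=
  exists x y z : T, [/\ x <> y, x <> z & y <> z].

(* Main.v *)
(** In a medial quandle the displacement group [D], generated by the maps
[L_a L_b^-1], is abelian, and conjugation by any left translation is one and
the same automorphism [t] of [D]; so [D] is a module over [Z[t]]. Every
submodule stable under [t^-1] has orbits forming a congruence, and
[L_(u x) = (1 - t)(u) L_x] for [u] in [D]. If [Q] is not quasi-reductive,
[1 - t] is thus injective, and the congruence [L_x = L_y] meets the orbit
congruence trivially; subdirect irreducibility then makes [x |-> L_x] injective
and [D] act freely, and it provides an element [u0 <> 0] of [D] lying in every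
nonzero submodule. Since [Z[t]] is noetherian, this forces [1 - t] to be
surjective as well, so [D] is transitive and right translations are bijective. *)

From HB Require Import structures.
Require Import Defs.
From mathcomp Require Import all_boot.
From mathcomp Require Import all_order all_algebra ring zify boolp.

Set Implicit Arguments.
Unset Strict Implicit.
Unset Printing Implicit Defensive.

Import GRing.Theory.

Local Open Scope ring_scope.

(** * Noetherian rings, Hilbert's basis theorem and surjectivity of [1 - t] *)

Definition is_ideal (R : comNzRingType) (I : R -> Prop) : Prop :=
  [/\ I 0, forall a b, I a -> I b -> I (a - b) & forall a b, I b -> I (a * b)].

Definition noetherian (R : comNzRingType) : Prop :=
  forall I : nat -> R -> Prop, (forall k, is_ideal (I k)) ->
  (forall k j a, (k <= j)%N -> I k a -> I j a) ->
  exists k, forall j a, I j a -> I k a.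

(** Descent on the absolute value: a nonzero [a] of some [I k] either divides the whole union of the
    chain, which is then [I k], or leaves a smaller nonzero remainder in a later ideal. *)
Lemma int_noetherian : noetherian int.
Proof.
move=> I idI monoI.
have [[k [a [Ia a_neq0]]]|I0] := pselect (exists k a, I k a /\ a <> 0); last first.
  exists 0%N => j a Ia; have [-> //|a_neq0] := eqVneq a 0; first by case: (idI 0%N).
  by case: I0; exists j, a; split=> //; apply/eqP.
have [n] := ubnP `|a|%N; elim: n => // n IHn in k a Ia a_neq0 *.
rewrite ltnS => le_an.
have [[j [b [Ib ndvd_ab]]]|dvdI] :=
    pselect (exists j b, I j b /\ ~ (a %| b)%Z); last first.
  exists k => j b Ib; have [_ _ mulI] := idI k.
  have /divzK <- : (a %| b)%Z by apply: contrapT => ?; apply: dvdI; exists j, b.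
  exact: mulI.
have [_ subI mulI] := idI (maxn j k).
apply: (IHn (maxn j k) (b %% a)%Z).
- have -> : (b %% a)%Z = b - (b %/ a)%Z * a by rewrite {2}(divz_eq b a); ring.
  apply: subI; first by apply: monoI Ib; rewrite leq_maxl.
  by apply: mulI; apply: monoI Ia; rewrite leq_maxr.
- by move=> b0; apply: ndvd_ab; apply/dvdz_mod0P.
have /eqP a0 := a_neq0; have := modz_ge0 b a0; have := ltz_mod b a0.
by lia.
Qed.

(* The chain of ideals is controlled by the coefficients [g`_n] of the elements
   of size at most [n.+1], which form ideals of [R] increasing both with [n] and
   along the chain; noetherianity is applied to the diagonal of this double
   family and then to its finitely many remaining rows. *)
Lemma hilbert_basis (R : comNzRingType) : noetherian R -> noetherian {poly R}.
Proof.
move=> noethR I idI monoI.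
pose L k n a := exists2 g, I k g & (size g <= n.+1)%N /\ g`_n = a.
have idL k n : is_ideal (L k n).
  have [I0 subI mulI] := idI k; split.
  - by exists 0; rewrite // size_poly0 coef0.
  - move=> a b [f If [sf <-]] [g Ig [sg <-]]; exists (f - g); first exact: subI.
    by rewrite coefB (leq_trans (size_polyD _ _)) // size_polyN geq_max sf.
  move=> a b [f If [sf <-]]; exists (a%:P * f); first exact: mulI.
  by rewrite coefCM mul_polyC (leq_trans (size_scale_leq _ _)).
have monoL k j n m a : (k <= j)%N -> (n <= m)%N -> L k n a -> L j m a.
  move=> le_kj le_nm [g Ig [sg <-]]; exists ('X^(m - n) * g).
    by have [_ _ mulI] := idI j; apply: mulI; apply: monoI Ig.
  rewrite coefXnM ltnNge leq_subr /= subKn //; split=> //.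
  rewrite (leq_trans (size_polyMleq _ _)) // size_polyXn /=.
  by rewrite -{2}(subnK le_nm) -addnS leq_add2l.
have [n0 diagL] : exists n0, forall j a, L j j a -> L n0 n0 a.
  by apply: noethR => [k|k j a le_kj]; [exact: idL | exact: monoL].
have [K [le_n0K rowL]] :
    exists K, (n0 <= K)%N /\ forall n j a, (n < n0)%N -> L j n a -> L K n a.
  move: {2}n0 => m; elim: m => [|m [K [le_n0K rowL]]]; first by exists n0.
  have [|k j a le_kj|k Lk] := noethR (L^~ m); [by [] | exact: monoL |].
  exists (maxn K k); split=> [|n j a]; first by rewrite leq_max le_n0K.
  rewrite ltnS leq_eqVlt => /orP[/eqP-> /Lk|/rowL rL /rL].
    by apply: monoL; rewrite // leq_maxr.
  by apply: monoL; rewrite // leq_maxl.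
have stabL n j a : L j n a -> L K n a.
  have [/rowL rL /rL //|le_n0n] := ltnP n n0.
  move=> /(monoL _ (maxn j n) _ (maxn j n)) Lj; apply: (monoL n0 _ n0) => //.
  by apply: diagL (Lj _ _); rewrite ?leq_maxl ?leq_maxr.
exists K => j f If.
(* Taking [i] at least [K] puts [I K] inside [I i], so elements of [I K] can cancel top coefficients
   of [f] within [I i]. *)
have [i [le_Ki {}If]] : exists i, (K <= i)%N /\ I i f.
  by exists (maxn j K); rewrite leq_maxr; split=> //; apply: monoI If; rewrite leq_maxl.
have [_ subIi _] := idI i; have [IK0 subIK mulIK] := idI K.
have [n] := ubnP (size f); elim: n => // n IHn in f If *.
rewrite ltnS => le_fn; case: n => [|n] in IHn le_fn *.
  by move: le_fn; rewrite leqn0 size_poly_eq0 => /eqP->.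
have [g Ig [sg gf]] : L K n f`_n by apply: (stabL _ i); exists f.
have Ifg : I K (f - g).
  apply: IHn; first by apply: subIi => //; apply: monoI Ig.
  rewrite ltnS; apply/leq_sizeP => m; rewrite leq_eqVlt => /orP[/eqP<-|lt_nm].
    by rewrite coefB gf subrr.
  by rewrite coefB !nth_default ?subrr // (leq_trans _ lt_nm).
have -> : f = f - g - (-1) * g by rewrite mulN1r opprK subrK.
by apply: subIK => //; apply: mulIK.
Qed.

(* Put [s = t ^+ n - p * (1 - t)], where [t ^+ n *: u = p *: (1 - t) *: u]: it
   kills [u] and is [1] modulo [1 - t]. By noetherianity the annihilators of
   [s ^+ k *: d] stabilize, and since [u] is a fraction of every nonzero
   [s ^+ k *: d], this forces [s ^+ k *: d = 0] for some [k]. *)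
Lemma essential_subr1_surjective (R : comNzRingType) (V : lmodType R) (t : R) (u : V) :
  noetherian R ->
  (forall v : V, t *: v = 0 -> v = 0) ->
  (forall v : V, (1 - t) *: v = 0 -> v = 0) ->
  u <> 0 ->
  (forall v : V, v <> 0 -> exists n p, t ^+ n *: u = p *: v) ->
  forall d : V, exists c, d = (1 - t) *: c.
Proof.
move=> noethR t_inj t1_inj u_neq0 ess d.
have tn_inj n (v : V) : t ^+ n *: v = 0 -> v = 0.
  elim: n v => [|n IHn] v; first by rewrite expr0 scale1r.
  by rewrite exprSr -scalerA => /IHn/t_inj.
have [n [p up]] : exists n p, t ^+ n *: u = p *: ((1 - t) *: u).
  by apply: ess => /t1_inj.
pose s := t ^+ n - p * (1 - t).
have su : s *: u = 0 by rewrite scalerBl up scalerA subrr.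
have s1 k : exists q, s ^+ k = 1 - (1 - t) * q.
  elim: k => [|k [q sk]]; first by exists 0; rewrite expr0 mulr0 subr0.
  have [r tn] : exists r, t ^+ n = 1 - (1 - t) * r.
    by exists (\sum_(i < n) t ^+ i); rewrite -[1 - t]opprB mulNr -subrX1; ring.
  exists (q + r + p - (1 - t) * q * (r + p)); rewrite exprS sk /s tn; ring.
suff [k sk0] : exists k, s ^+ k *: d = 0.
  have [q sk] := s1 k; exists (q *: d); apply/eqP.
  by rewrite scalerA -subr_eq0 -{1}(scale1r d) -scalerBl -sk sk0.
apply: contrapT => sd_neq0.
have [k|k j f le_kj fk|k annk] := noethR (fun k f => (f * s ^+ k) *: d = 0).
- split=> [|f g fd gd|f g gd]; first by rewrite mul0r scale0r.
    by rewrite mulrBl scalerBl fd gd subr0.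
  by rewrite -mulrA -scalerA gd scaler0.
- by rewrite -(subnK le_kj) exprD mulrCA -scalerA fk scaler0.
have [m [f uf]] : exists m f, t ^+ m *: u = f *: (s ^+ k *: d).
  by apply: ess => sd0; apply: sd_neq0; exists k.
apply: u_neq0; apply: (tn_inj m); rewrite uf scalerA.
(* [f * s ^+ k.+1] kills [d] because [s] kills [t ^+ m *: u]; stability brings this back to exponent
   [k]. *)
apply: (annk k.+1); rewrite exprS mulrCA -scalerA -[(f * _) *: _]scalerA -uf.
by rewrite scalerA mulrC -scalerA su scaler0.
Qed.

(** * Abelian groups with an endomorphism as modules over integer polynomials *)

Section PolyModule.
Variables (V : zmodType) (t : {additive V -> V}).

(** This is [p(t)] applied to [v]. *)
Definition pscale (p : {poly int}) (v : V) : V :=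
  \sum_(i < size p) iter i t v *~ p`_i.

Let pscaleE n (p : {poly int}) (v : V) :
  (size p <= n)%N -> pscale p v = \sum_(i < n) iter i t v *~ p`_i.
Proof.
move=> le_pn; rewrite /pscale (big_ord_widen _ (fun i => iter i t v *~ p`_i) le_pn).
rewrite [RHS](bigID (fun i : 'I_n => (i < size p)%N)) /= [X in _ + X]big1 ?addr0 //.
by move=> i; rewrite -leqNgt => /(nth_default 0)->; rewrite mulr0z.
Qed.

Lemma pscaleDl v : {morph pscale^~ v : p q / p + q}.
Proof.
move=> p q; pose n := maxn (size p) (size q).
rewrite !(@pscaleE n) ?leq_maxl ?leq_maxr ?size_polyD //.
by rewrite -big_split; apply: eq_bigr => i _; rewrite coefD mulrzDr.
Qed.

Lemma pscaleDr : right_distributive pscale +%R.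
Proof.
move=> p u v; rewrite /pscale -big_split; apply: eq_bigr => i _ /=.
rewrite -mulrzDl; congr (_ *~ _).
by elim: (i : nat) => //= n ->; rewrite raddfD.
Qed.

Lemma pscaleC c v : pscale c%:P v = v *~ c.
Proof. by rewrite (@pscaleE 1) ?size_polyC_leq1 // big_ord1 coefC. Qed.

Lemma pscaleMX p v : pscale (p * 'X) v = t (pscale p v).
Proof.
have le_pX : (size (p * 'X)%R <= (size p).+1)%N.
  by rewrite (leq_trans (size_polyMleq _ _)) // size_polyX addn2.
rewrite (pscaleE _ le_pX) big_ord_recl coefMX mulr0z add0r raddf_sum.
by apply: eq_bigr => i _; rewrite coefMX raddfMz.
Qed.

Lemma pscaleX v : pscale 'X v = t v.
Proof. by rewrite -(mul1r 'X) pscaleMX pscaleC mulr1z. Qed.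

Lemma pscale1 : left_id 1 pscale.
Proof. by move=> v; rewrite pscaleC mulr1z. Qed.

Lemma pscaleA p q v : pscale p (pscale q v) = pscale (p * q) v.
Proof.
elim/poly_ind: p => [|p c IHp]; first by rewrite mul0r !pscaleC !mulr0z.
rewrite mulrDl !pscaleDl mulrAC !pscaleMX IHp pscaleC; congr (_ + _).
elim/poly_ind: q {IHp} => [|q d IHq]; first by rewrite mulr0 !pscaleC mulr0z mul0rz.
rewrite mulrDr mulrA !pscaleDl !pscaleMX -IHq -polyCM !pscaleC mulrzDl raddfMz.
by rewrite mulrC mulrzA.
Qed.

End PolyModule.

(** An alias of [V] that records [t], on which the module structure depends. *)
Definition poly_module (V : zmodType) (t : {additive V -> V}) : Type := V.

HB.instance Definition _ (V : zmodType) (t : {additive V -> V}) :=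
  GRing.Zmodule.on (poly_module t).

HB.instance Definition _ (V : zmodType) (t : {additive V -> V}) :=
  GRing.Zmodule_isLmodule.Build {poly int} (poly_module t) (pscaleA t)
    (pscale1 t) (pscaleDr t) (pscaleDl t).

Lemma essential_subr_surjective (V : zmodType) (t t' : {additive V -> V}) (u : V) :
  cancel t t' -> cancel t' t ->
  (forall v, t v = v -> v = 0) ->
  u <> 0 ->
  (forall N : V -> Prop, (forall v w, N v -> N w -> N (v - w)) ->
     (forall v, N v -> N (t v)) -> (forall v, N v -> N (t' v)) ->
     (exists2 v, N v & v <> 0) -> N u) ->
  forall d, exists c, d = c - t c.
Proof.
move=> tK t'K t_fix u_neq0 ess d.
have XE (v : poly_module t) : 'X *: v = t v by apply: pscaleX.
have X1E (v : poly_module t) : (1 - 'X) *: v = v - t v.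
  by rewrite scalerBl scale1r XE.
have [v|v|v v_neq0|c ->] := @essential_subr1_surjective _ (poly_module t) 'X u
  (hilbert_basis int_noetherian) _ _ u_neq0 _ d; last by exists c; rewrite X1E.
- by rewrite XE => tv0; apply: (can_inj tK); rewrite tv0 raddf0.
- by rewrite X1E => /eqP; rewrite subr_eq0 => /eqP tv; apply: t_fix.
(* ['X] has no inverse in the ring, so the closure of [v] under [t] and [t'] is described by
   clearing powers of ['X]. *)
pose N (w : poly_module t) := exists n p, 'X^n *: w = p *: v.
apply: (ess N); last by exists v => //; exists 0%N, 1.
- move=> w1 w2 [n [p Np]] [m [q Nq]].
  exists (m + n)%N, ('X^m * p - 'X^n * q).
  rewrite scalerBr scalerBl -!scalerA -Np -Nq !scalerA -!exprD.
  by rewrite [(n + m)%N]addnC.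
- move=> w [n [p Np]]; exists n, ('X * p).
  by rewrite -XE scalerA mulrC -scalerA Np scalerA.
move=> w [n [p Np]]; exists n.+1, p.
by rewrite exprSr -scalerA XE t'K.
Qed.

(** * Displacements, and their commutation in a medial quandle *)

Section Displacement.
Local Open Scope quandle_scope.
Variable Q : quandle.
Implicit Types (a b c d e x y z : Q) (f g : Q -> Q).

Lemma qop_inj x : injective (qop x).
Proof. exact: can_inj (qop_ldivK x). Qed.

Lemma qldiv_distr x y z : x \ (y * z) = (x \ y) * (x \ z).
Proof. by apply: (@qop_inj x); rewrite qop_distr !qldiv_opK. Qed.

Lemma qop_ldiv_distr x y z : x * (y \ z) = (x * y) \ (x * z).
Proof. by apply: (@qop_inj (x * y)); rewrite -qop_distr !qldiv_opK. Qed.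

Lemma qldiv_ldiv_distr x y z : x \ (y \ z) = (x \ y) \ (x \ z).
Proof. by apply: (@qop_inj (x \ y)); rewrite -qldiv_distr !qldiv_opK. Qed.

(* The second map is the inverse of the first one. *)
Inductive displacement : (Q -> Q) -> (Q -> Q) -> Prop :=
| displacement_gen a b :
    displacement (fun x => a * (b \ x)) (fun x => b * (a \ x))
| displacement_id : displacement id id
| displacement_comp f f' g g' :
    displacement f f' -> displacement g g' -> displacement (f \o g) (g' \o f').

Lemma displacement_sym f f' : displacement f f' -> displacement f' f.
Proof.
elim=> [a b||{}f {}f' g g' _ Hf _ Hg]; first exact: displacement_gen.
  exact: displacement_id.
exact: displacement_comp.
Qed.

Lemma displacement_cancel f f' : displacement f f' -> cancel f f'.
Proof.
by elim=> [a b x||{}f {}f' g g' _ Hf _ Hg x] //=;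
  rewrite ?qop_ldivK ?qldiv_opK ?Hf ?Hg.
Qed.

Lemma displacement_morph f f' : displacement f f' -> {morph f : x y / x * y}.
Proof.
elim=> [a b x y||{}f {}f' g g' _ Hf _ Hg x y] //=.
  by rewrite qldiv_distr qop_distr.
by rewrite Hg Hf.
Qed.

Lemma displacement_lmg f f' : displacement f f' -> left_mul_group f.
Proof.
elim=> [a b||{}f {}f' g g' _ Hf _ Hg]; last 2 first.
- exact: lmg_id.
- exact: lmg_comp.
apply: (@lmg_comp _ (ltrans a) (qldiv b)); first exact: lmg_gen.
exact: lmg_inv (lmg_gen b) (qop_ldivK b) (qldiv_opK b).
Qed.

(** [L_e] is an automorphism, so it conjugates [L_a L_b^-1] to [L_(e * a) L_(e * b)^-1]. *)
Lemma displacement_conj e f f' : displacement f f' ->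
  displacement (fun x => e * f (e \ x)) (fun x => e * f' (e \ x)).
Proof.
elim=> [a b||{}f {}f' g g' _ Hf _ Hg].
- have <- : (fun x => (e * a) * ((e * b) \ x)) = (fun x => e * (a * (b \ (e \ x)))).
    by apply: funext => x; rewrite [RHS]qop_distr [e * (b \ _)]qop_ldiv_distr qldiv_opK.
  have <- : (fun x => (e * b) * ((e * a) \ x)) = (fun x => e * (b * (a \ (e \ x)))).
    by apply: funext => x; rewrite [RHS]qop_distr [e * (a \ _)]qop_ldiv_distr qldiv_opK.
  exact: displacement_gen.
- have -> : (fun x => e * (id (e \ x))) = id.
    by apply: funext => x; rewrite qldiv_opK.
  exact: displacement_id.
have -> : (fun x => e * ((f \o g) (e \ x))) =
    (fun x => e * f (e \ x)) \o (fun x => e * g (e \ x)).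
  by apply: funext => x /=; rewrite qop_ldivK.
have -> : (fun x => e * ((g' \o f') (e \ x))) =
    (fun x => e * g' (e \ x)) \o (fun x => e * f' (e \ x)).
  by apply: funext => x /=; rewrite qop_ldivK.
exact: displacement_comp.
Qed.

Lemma displacement_conjV e f f' : displacement f f' ->
  displacement (fun x => e \ f (e * x)) (fun x => e \ f' (e * x)).
Proof.
elim=> [a b||{}f {}f' g g' _ Hf _ Hg].
- have <- : (fun x => (e \ a) * ((e \ b) \ x)) = (fun x => e \ (a * (b \ (e * x)))).
    by apply: funext => x; rewrite [RHS]qldiv_distr [e \ (b \ _)]qldiv_ldiv_distr qop_ldivK.
  have <- : (fun x => (e \ b) * ((e \ a) \ x)) = (fun x => e \ (b * (a \ (e * x)))).
    by apply: funext => x; rewrite [RHS]qldiv_distr [e \ (a \ _)]qldiv_ldiv_distr qop_ldivK.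
  exact: displacement_gen.
- have -> : (fun x => e \ (id (e * x))) = id.
    by apply: funext => x; rewrite qop_ldivK.
  exact: displacement_id.
have -> : (fun x => e \ ((f \o g) (e * x))) =
    (fun x => e \ f (e * x)) \o (fun x => e \ g (e * x)).
  by apply: funext => x /=; rewrite qldiv_opK.
have -> : (fun x => e \ ((g' \o f') (e * x))) =
    (fun x => e \ g' (e * x)) \o (fun x => e \ f' (e * x)).
  by apply: funext => x /=; rewrite qldiv_opK.
exact: displacement_comp.
Qed.

Hypothesis hmed : medial Q.

(** Applying [L_x] to both sides gives exactly the medial law. *)
Lemma medial_opAC x y u z : y * (x \ (u * z)) = u * (x \ (y * z)).
Proof.
have [medop _ _] := hmed.
by apply: (@qop_inj x); rewrite [LHS]qop_distr [RHS]qop_distr !qldiv_opK medop.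
Qed.

Lemma medial_ldivAC x y u z : x \ (y * (u \ z)) = u \ (y * (x \ z)).
Proof.
by apply: (@qop_inj x); rewrite qldiv_opK medial_opAC qldiv_opK.
Qed.

Lemma displacement_comm f f' g g' :
  displacement f f' -> displacement g g' -> f \o g =1 g \o f.
Proof.
move=> Hf; elim: Hf g g' => [a b||f1 f1' f2 f2' _ IH1 _ IH2] g g' // Hg x /=.
  elim: Hg x => [c d||g1 g1' g2 g2' _ IH1 _ IH2] x //=.
    (* First [a] and [c] are exchanged around [L_b^-1], then [b] and [d] around [L_a]. *)
    by rewrite medial_opAC [b \ _]medial_ldivAC.
  by have /= -> := IH1 (g2 x); have /= -> := IH2 x.
by have /= -> := IH2 _ _ Hg x; have /= -> := IH1 _ _ Hg (f2 x).
Qed.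

End Displacement.

(** * The displacement group as an abelian group with automorphism *)

(** The parameter [hmed] lets the type carry its commutative group structure. *)
Definition dis (Q : quandle) (hmed : medial Q) : Type :=
  {fg : (Q -> Q) * (Q -> Q) | displacement fg.1 fg.2}.

Section DisplacementModule.
Local Open Scope quandle_scope.
Variables (Q : quandle) (hmed : medial Q).
Local Notation D := (dis hmed).

Definition dact (u : D) : Q -> Q := (sval u).1.
Definition mkdis f f' (Hf : displacement f f') : D :=
  exist (fun fg => displacement fg.1 fg.2) (f, f') Hf.

(** The second map is determined as the inverse of the first, and proofs are irrelevant. *)
Lemma dis_eq (u v : D) : dact u =1 dact v -> u = v.
Proof.
case: u v => [[f f'] Hf] [[g g'] Hg]; rewrite /dact /= in Hf Hg * => /funext eq_fg.
rewrite -{g}eq_fg in Hg *; apply: eq_exist; congr pair; apply: funext => x.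
apply: (can_inj (displacement_cancel Hf)).
by rewrite (displacement_cancel (displacement_sym Hf))
  (displacement_cancel (displacement_sym Hg)).
Qed.

Definition dis0 : D := mkdis (displacement_id Q).
Definition disN (u : D) : D := mkdis (displacement_sym (svalP u)).
Definition disD (u v : D) : D := mkdis (displacement_comp (svalP u) (svalP v)).

Lemma disDA : associative disD.
Proof. by move=> u v w; apply: dis_eq. Qed.

Lemma disDC : commutative disD.
Proof.
by move=> u v; apply: dis_eq; apply: displacement_comm (svalP u) (svalP v).
Qed.

Lemma dis0D : left_id dis0 disD.
Proof. by move=> u; apply: dis_eq. Qed.

Lemma disND : left_inverse dis0 disN disD.
Proof.
by move=> u; apply: dis_eq => x; apply: displacement_cancel (svalP u) x.
Qed.

HB.instance Definition _ := gen_eqMixin D.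
HB.instance Definition _ := gen_choiceMixin D.
HB.instance Definition _ := GRing.isZmodule.Build D disDA disDC dis0D disND.

Lemma dactD (u v : D) x : dact (u + v) x = dact u (dact v x).
Proof. by []. Qed.

Lemma dactK (u : D) : cancel (dact u) (dact (- u)).
Proof. by move=> x; rewrite -dactD addNr. Qed.

Lemma dactNK (u : D) : cancel (dact (- u)) (dact u).
Proof. by move=> x; rewrite -dactD subrr. Qed.

Lemma dact_orbit (u : D) x : same_orbit x (dact u x).
Proof. by exists (dact u) => //; apply: displacement_lmg (svalP u). Qed.

Lemma dact_exists (y x : Q) : exists u : D, forall z, dact u z = y * (x \ z).
Proof. by exists (mkdis (displacement_gen y x)). Qed.

Variable e : Q.

Definition conjd (u : D) : D := mkdis (displacement_conj e (svalP u)).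
Definition conjdV (u : D) : D := mkdis (displacement_conjV e (svalP u)).

Lemma conjd_is_zmod_morphism : zmod_morphism conjd.
Proof.
have conjdD u v : conjd (u + v) = conjd u + conjd v.
  by apply: dis_eq => x; rewrite dactD /dact /= qop_ldivK.
by move=> u v; apply: (addIr (conjd v)); rewrite -conjdD !subrK.
Qed.

Lemma conjdV_is_zmod_morphism : zmod_morphism conjdV.
Proof.
have conjdD u v : conjdV (u + v) = conjdV u + conjdV v.
  by apply: dis_eq => x; rewrite dactD /dact /= qldiv_opK.
by move=> u v; apply: (addIr (conjdV v)); rewrite -conjdD !subrK.
Qed.

HB.instance Definition _ := GRing.isZmodMorphism.Build D D conjd conjd_is_zmod_morphism.
HB.instance Definition _ := GRing.isZmodMorphism.Build D D conjdV conjdV_is_zmod_morphism.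

Lemma conjdK : cancel conjd conjdV.
Proof. by move=> u; apply: dis_eq => x; rewrite /dact /= !qop_ldivK. Qed.

Lemma conjdVK : cancel conjdV conjd.
Proof. by move=> u; apply: dis_eq => x; rewrite /dact /= !qldiv_opK. Qed.

(* [conjd] is conjugation by [e], but any other left translation acts on the
   abelian displacement group in the same way. *)
Lemma op_dactr x (u : D) y : x * dact u y = dact (conjd u) (x * y).
Proof.
(* With [v = L_x L_e^-1], the claim is that [v] and [conjd u] commute at [e * y]. *)
have [v vE] := dact_exists x e.
have /= := displacement_comm hmed (svalP v) (svalP (conjd u)) (e * y).
by rewrite -!/(dact _) !vE /dact /= !qop_ldivK.
Qed.

(** As [u] is an automorphism, [u x * y = u (x * u^-1 y)]; then [u^-1] is moved out through
    [L_x]. *)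
Lemma op_dactl (u : D) x y : dact u x * y = dact (u - conjd u) (x * y).
Proof.
rewrite dactD -raddfN -op_dactr [RHS](displacement_morph (svalP u)).
by rewrite -!/(dact _) dactNK.
Qed.

Lemma ldiv_dactr x (u : D) y : x \ dact u y = dact (conjdV u) (x \ y).
Proof.
by apply: (@qop_inj _ x); rewrite op_dactr conjdVK !qldiv_opK.
Qed.

Lemma ldiv_dactl (u : D) x y :
  dact u x \ y = dact (conjdV (conjd u - u)) (x \ y).
Proof.
apply: (@qop_inj _ (dact u x)); rewrite qldiv_opK op_dactl op_dactr conjdVK.
by rewrite qldiv_opK -dactD -opprB addNr.
Qed.

Definition orbit_rel (N : D -> Prop) (x y : Q) := exists2 u, N u & dact u x = y.

(** Moving [x] by [u] and [y] by [v] moves [x * y] by [t v + (1 - t) u]; left division also brings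
    in [t^-1]. *)
Lemma orbit_rel_congruence (N : D -> Prop) :
  N 0 ->
  (forall u v, N u -> N v -> N (u - v)) ->
  (forall u, N u -> N (conjd u)) -> (forall u, N u -> N (conjdV u)) ->
  congruence (orbit_rel N).
Proof.
move=> N0 NB Nt Nt'.
have NN u : N u -> N (- u) by move=> Nu; rewrite -sub0r; apply: NB.
have ND u v : N u -> N v -> N (u + v).
  by move=> Nu Nv; rewrite -(opprK v); apply: NB => //; apply: NN.
split=> [x|x _ [u Nu <-]|x _ _ [u Nu <-] [v Nv <-]||].
- by exists 0.
- by exists (- u); [exact: NN | exact: dactK].
- by exists (v + u); [exact: ND | exact: dactD].
- move=> x _ y _ [u Nu <-] [v Nv <-]; exists (conjd v + (u - conjd u)).
    by apply: ND; [exact: Nt | apply: NB => //; exact: Nt].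
  by rewrite op_dactr op_dactl -dactD.
move=> x _ y _ [u Nu <-] [v Nv <-]; exists (conjdV v + conjdV (conjd u - u)).
  by apply: ND; apply: Nt' => //; apply: NB => //; exact: Nt.
by rewrite ldiv_dactr ldiv_dactl -dactD.
Qed.

End DisplacementModule.

(** * Equality of left translations, and projection quandles *)

Section Quandle.
Local Open Scope quandle_scope.
Variable Q : quandle.

(** [L_(x * y) = L_x L_y L_x^-1] and [L_(x \ y) = L_x^-1 L_y L_x]. *)
Lemma ltrans_congruence : congruence (fun x y : Q => ltrans x =1 ltrans y).
Proof.
have opl (x y z : Q) : (x * y) * z = x * (y * (x \ z)).
  by rewrite qop_distr qldiv_opK.
have ldivl (x y z : Q) : (x \ y) * z = x \ (y * (x * z)).
  by rewrite qldiv_distr qop_ldivK.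
have ldivE (x y z : Q) : ltrans x =1 ltrans y -> x \ z = y \ z.
  by move=> xy; apply: (@qop_inj _ x); rewrite qldiv_opK [RHS]xy /ltrans qldiv_opK.
split=> [x|x y xy z|x y z xy yz w|x x' y y' xx' yy' z|x x' y y' xx' yy' z] //.
- by rewrite xy.
- by rewrite /ltrans !opl (ldivE _ _ _ xx') [LHS]xx' /ltrans; congr (_ * _); exact: yy'.
rewrite /ltrans !ldivl (ldivE _ _ _ xx'); congr (_ \ _).
by rewrite [LHS]yy' /ltrans; congr (_ * _); exact: xx'.
Qed.

(* On a projection quandle every equivalence relation is a congruence. *)
Lemma projection_not_subdirectly_irreducible :
  (forall x y : Q, x * y = y) -> more_than_two Q -> ~ subdirectly_irreducible Q.
Proof.
move=> opE [a [b [c [ab ac bc]]]] [x [y [Mxy xy]]].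
have ldivE (u v : Q) : u \ v = v by apply: (@qop_inj _ u); rewrite qldiv_opK opE.
have [z [xz yz]] : exists z, x <> z /\ y <> z.
  apply: contrapT => no_z.
  have xyP z : z = x \/ z = y.
    by apply: contrapT => /not_orP[zx zy]; apply: no_z; exists z; split; apply: nesym.
  by case: (xyP a) (xyP b) (xyP c) ab ac bc => -> [] -> [] ->.
(* Only [x] and [z] are merged, so the monolith pair [x], [y] stays separated. *)
pose r u v := u = v \/ (u = x \/ u = z) /\ (v = x \/ v = z).
suff [//|[_ [/esym|]//]] : r x y.
apply: Mxy; last by exists x, z; split=> //; right; split; [left | right].
split=> [u|u v|u v w|u u' v v' _|u u' v v' _]; rewrite ?opE ?ldivE //.
- by left.
- by case=> [->|[]]; [left | right].
by case=> [->|[ru rv]] // [<-|[_ rw]]; right.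
Qed.

End Quandle.

(** * Latinity in the absence of quasi-reductivity *)

Theorem theorem6p4 (Q : quandle) (hmed : medial Q)
    (hsi : subdirectly_irreducible Q) (hcard : more_than_two Q) :
  latin Q \/ quasi_reductive Q.
Proof.
have [?|nqr] := pselect (quasi_reductive Q); [by right | left].
have [e [y [Mey ey]]] := hsi.
pose t : {additive dis hmed -> dis hmed} := conjd e.
pose t' : {additive dis hmed -> dis hmed} := conjdV e.
have eq_orbit (u : dis hmed) x : ltrans (dact u x) =1 ltrans x -> dact u x = x.
  move=> eqL; apply: contrapT => ux; apply: nqr; exists x, (dact u x).
  by split; [exact: nesym | exact: dact_orbit | move=> z; rewrite eqL].
have t_fix (u : dis hmed) : t u = u -> u = 0.
  move=> tu; apply: dis_eq => x; apply: eq_orbit => z.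
  by rewrite [LHS](op_dactl e) [conjd e u]tu subrr.
have [u0 [u0e u0_neq0]] : exists u : dis hmed, dact u e = y /\ u <> 0.
  have [[u [x ux]]|act0] := pselect (exists (u : dis hmed) x, dact u x <> x).
    have congD := @orbit_rel_congruence _ hmed e (fun=> True) I
      (fun _ _ _ _ => I) (fun _ _ => I) (fun _ _ => I).
    have [|v _ ve] := Mey _ congD.
      by exists x, (dact u x); split; [exists u | exact: nesym].
    by exists v; split=> // v0; apply: ey; rewrite -ve v0.
  (* If all displacements are trivial, [L_x L_z^-1] fixes [z = z * z], whence [x * z = z]. *)
  case: (projection_not_subdirectly_irreducible _ hcard hsi) => x z.
  have [v vE] := dact_exists hmed x z.
  have : dact v z = z by apply: contrapT => vz; apply: act0; exists v, z.
  by rewrite vE -{2}(qop_idem z) qop_ldivK.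
(* Otherwise the monolith gives [L_e = L_y], although [y = u0 e] lies in the orbit of [e]. *)
have faithful (x z : Q) : ltrans x =1 ltrans z -> x = z.
  move=> eqL; apply: contrapT => xz.
  have eqLey : ltrans e =1 ltrans y by apply: Mey (ltrans_congruence Q) _; exists x, z.
  by apply: ey; rewrite -u0e eq_orbit // u0e => w; rewrite eqLey.
(* If [u] fixes [x], then [(1 - t) u] fixes every [x * w], hence all of [Q]. *)
have free (u : dis hmed) x : dact u x = x -> u = 0.
  move=> ux; apply/t_fix/esym/eqP; rewrite -subr_eq0; apply/eqP/dis_eq => z.
  by rewrite -[z in LHS](qldiv_opK x) -op_dactl ux qldiv_opK.
have free2 (u v : dis hmed) x : dact u x = dact v x -> u = v.
  move=> uv; apply/eqP; rewrite -subr_eq0; apply/eqP/(free _ x).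
  by rewrite addrC dactD uv dactK.
have t_surj (d : dis hmed) : exists c, d = c - t c.
  apply: (@essential_subr_surjective _ t t' u0) => //.
  - exact: conjdK.
  - exact: conjdVK.
  move=> N NB Nt Nt' [v Nv v_neq0].
  (* The orbits of [N] relate [e] to [y = u0 e], and freeness turns this into [N u0]. *)
  have N0 : N 0 by rewrite -(subrr v); apply: NB.
  have [|w Nw we] := Mey _ (orbit_rel_congruence N0 NB Nt Nt').
    exists e, (dact v e); split; first by exists v.
    by move=> /esym/free.
  by rewrite -(free2 w u0 e) // we.
have trans x z : exists u : dis hmed, z = dact u x.
  (* Writing [L_z L_x^-1] as [(1 - t) u] gives [L_(u x) = L_z]. *)
  have [v vE] := dact_exists hmed z x; have [u uE] := t_surj v.
  exists u; apply: faithful => w.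
  by rewrite /ltrans (op_dactl e) -[conjd e u]/(t u) -uE vE qop_ldivK.
move=> b.
have /choice[g gK] : forall z, exists x, rtrans b x = z.
  move=> z.
  (* Since [b * b = b], [R_b] sends [u b] to [((1 - t) u) b]. *)
  have [v ->] := trans b z; have [u ->] := t_surj v.
  by exists (dact u b); rewrite /rtrans (op_dactl e) qop_idem.
exists g => //; apply: inj_can_sym gK _ => x1 x2.
have [u1 ->] := trans b x1; have [u2 ->] := trans b x2.
rewrite /rtrans !(op_dactl e) !qop_idem => /free2 eq_u.
(* Freeness gave [(1 - t) u1 = (1 - t) u2], so [t] fixes [u1 - u2]. *)
suff /eqP : u1 - u2 = 0 by rewrite subr_eq0 => /eqP->.
apply: t_fix; rewrite raddfB -[u1 in RHS](subrK (t u1)) [u1 - _]eq_u.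
by rewrite addrAC [u2 - _]addrC addrK addrC.
Qed.
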